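(* Let $n,s,k$ be integers with $k\geq 2$, $s\geq 3$ and $n\geq sk+1$. Then the automorphism group of the graph $G(n,k,s)$ is the dihedral group $D_{2n}$ (acting naturally on $[n]$ viewed as the vertices of an $n$-cycle).
   Context: Let $[n]=\{1,\dots,n\}$. A subset $S\subseteq[n]$ is $s$-stable if for all distinct $i,j\in S$ we have $s\leq |i-j|\leq n-s$. $[n]^k_s$ denotes the family of $s$-stable $k$-element subsets of $[n]$. The graph $G(n,k,s)$ has vertex set $[n]$, and two distinct vertices $i,j$ are adjacent iff there is no $S\in[n]^k_s$ with $\{i,j\}\subseteq S$. $D_{2n}$ denotes the dihedral group of order $2n$, i.e. the group of permutations of $[n]$ generated by $i\mapsto i+1$ and $i\mapsto -i$ (arithmetic modulo $n$, with $n$ representing $0$). *)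

(* Defs.v *)
From mathcomp Require Import all_boot all_order all_algebra all_fingroup.

Set Implicit Arguments.
Unset Strict Implicit.
Unset Printing Implicit Defensive.

Import GroupScope.
Local Open Scope nat_scope.

(* Encoding: [n] = {1, ..., n} is represented by 'I_n = {0, ..., n-1}, the
   vertex n being represented by 0.  Stability is unaffected, since this turns
   |i - n| into n - |i - n| and the interval [s, n - s] is invariant under
   d |-> n - d. *)

Definition stable (n s : nat) (S : {set 'I_n}) : bool :=
  [forall i in S, forall j in S, (i != j) ==> (s <= `|i - j| <= n - s)].

Definition stable_sets (n k s : nat) : {set {set 'I_n}} :=
  [set S : {set 'I_n} | (#|S| == k) && stable s S].

Definition G (n k s : nat) : rel 'I_n :=
  fun i j => (i != j) &&
    ~~ [exists S in stable_sets n k s, [set i; j] \subset S].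

Definition graph_aut (T : finType) (e : rel T) : {set {perm T}} :=
  [set p : {perm T} | [forall x, forall y, e (p x) (p y) == e x y]].

Lemma graph_autP (T : finType) (e : rel T) (p : {perm T}) :
  reflect (forall x y, e (p x) (p y) = e x y) (p \in graph_aut e).
Proof.
rewrite inE; apply: (iffP forallP) => [h x y | h x].
  exact/eqP/(forallP (h x)).
by apply/forallP => y; apply/eqP.
Qed.

Lemma graph_aut_group_set (T : finType) (e : rel T) : group_set (graph_aut e).
Proof.
apply/group_setP; split=> [|p q /graph_autP hp /graph_autP hq].
  by apply/graph_autP => x y; rewrite !perm1.
by apply/graph_autP => x y; rewrite !permM hq hp.
Qed.

Canonical graph_aut_group (T : finType) (e : rel T) :=
  Group (graph_aut_group_set e).

Lemma opp_ord_subproof (n : nat) (i : 'I_n) : (n - i) %% n < n.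
Proof. by rewrite ltn_mod; case: n i => [[]|]. Qed.

Definition opp_ord (n : nat) (i : 'I_n) : 'I_n := Ordinal (opp_ord_subproof i).

Lemma opp_ordK (n : nat) : involutive (@opp_ord n).
Proof.
move=> i; apply: val_inj => /=.
case: (posnP i) => [i0 | i_gt0]; first by rewrite i0 subn0 modnn subn0 modnn.
have lt_in := ltn_ord i.
rewrite (@modn_small (n - i)) ?ltn_subrL ?i_gt0 ?(leq_trans _ lt_in) //.
by rewrite subKn ?modn_small // ltnW.
Qed.

Definition rotation (n : nat) : {perm 'I_n} := perm (@ordS_inj n).

Definition reflection (n : nat) : {perm 'I_n} := perm (inv_inj (@opp_ordK n)).

Definition dihedral (n : nat) : {group {perm 'I_n}} :=
  <<[set rotation n; reflection n]>>%G.

(* Main.v *)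
(** With [r = n - k * s], two points at cyclic distance [d] lie in a common
    stable [k]-set iff [d] lies in one of the blocks [[m * s, m * s + r]] with
    [0 < m < k], so [G] is a circulant graph and contains the dihedral group in
    its automorphism group.  Conversely, for adjacent [x] and [y] count the
    non-neighbours of [x] that are not non-neighbours of [y].  If [y = x + 1],
    each block contributes only its left end, so there are at most [k - 1].  If
    [y <> x + 1] and [y <> x - 1], each block contributes at least one point and
    some block at least two.  Hence automorphisms send [n]-cycle edges to
    [n]-cycle edges.  When [r >= s - 1] the blocks merge into a single one, and
    the same argument applies with [k = 2]. *)

Require Import Defs.
From mathcomp Require Import all_boot all_order all_algebra all_fingroup.
From mathcomp Require Import zify.

Set Implicit Arguments.
Unset Strict Implicit.
Unset Printing Implicit Defensive.

Local Open Scope nat_scope.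

(** * Cyclic distances and the blocks of stable gaps *)

(* For x, y < n this is (y - x) mod n. *)
Definition cdist (n x y : nat) : nat := if x <= y then y - x else y + n - x.

Definition stable_gap (k s r d : nat) : bool :=
  [exists m : 'I_k, (0 < m) && (m * s <= d <= m * s + r)].

Lemma stable_gapP (k s r d : nat) :
  reflect (exists m, [/\ 0 < m, m < k, m * s <= d & d <= m * s + r])
          (stable_gap k s r d).
Proof.
apply: (iffP existsP) => [[m /and3P[m0 h1 h2]]|[m [m0 mk h1 h2]]].
  by exists m; split.
by exists (Ordinal mk); rewrite /= m0 h1 h2.
Qed.

Lemma mulnS_le (i j s : nat) : i < j -> i * s + s <= j * s.
Proof. by move=> lt_ij; rewrite addnC -mulSn leq_mul2r lt_ij orbT. Qed.

(** The reflection [d |-> n - d] maps block [m] onto block [k - m]. *)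
Lemma stable_gap_compl (n k s r d : nat) :
  n = k * s + r -> d <= n -> stable_gap k s r d -> stable_gap k s r (n - d).
Proof.
move=> -> le_dn /stable_gapP[m [m0 mk h1 h2]]; apply/stable_gapP.
exists (k - m); have -> : (k - m) * s = k * s - m * s by rewrite mulnBl.
have := mulnS_le s mk; split; lia.
Qed.

(** With [s <= r.+1] no integer lies between consecutive blocks, so their union is [[s, n - s]], the
    single block for [k = 2]. *)
Lemma stable_gap_collapse (n k s r d : nat) :
  1 < k -> n = k * s + r -> s <= r.+1 ->
  stable_gap k s r d = stable_gap 2 s (n - 2 * s) d.
Proof.
move=> k1 -> sr.
have hk : 2 * s <= k * s by rewrite leq_mul2r k1 orbT.
apply/stable_gapP/stable_gapP => [[m [m0 mk h1 h2]]|[[|[|m]] [] // _ _ h1 h2]].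
  exists 1; have := mulnS_le s mk; have := mulnS_le s m0; split; lia.
have k'k : k.-1 * s = k * s - s by rewrite -subn1 mulnBl mul1n.
(* Inside a long last block the quotient [d %/ s] may exceed [k.-1], so that block is treated
   separately. *)
case: (leqP (k.-1 * s) d) => hd; first by exists k.-1; split; lia.
case: s => [|s] in sr hk h1 h2 k'k hd *; first by lia.
exists (d %/ s.+1); rewrite divn_gt0 //.
split; [lia | | exact: leq_trunc_div |].
  by rewrite ltn_divLR //; lia.
have := ltn_ceil d (ltn0Sn s); rewrite mulSn; lia.
Qed.

(** * Adjacency in [G] expressed through stable gaps *)

Lemma stableP (n s : nat) (S : {set 'I_n}) :
  reflect
    (forall i j : 'I_n, i \in S -> j \in S -> i < j -> s <= j - i <= n - s)
    (stable s S).
Proof.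
apply: (iffP forall_inP) => [h i j iS jS ij|h i iS].
  move: (implyP (forall_inP (h i iS) j jS)); rewrite neq_ltn ij => /(_ isT).
  by rewrite distnEr // ltnW.
apply/forall_inP => j jS; apply/implyP => /negPf ij.
case: (ltngtP i j) => [lt_ij|lt_ji|/val_inj e]; last by rewrite e eqxx in ij.
  by rewrite distnEr ?h // ltnW.
by rewrite distnEl ?h // ltnW.
Qed.

(** A packing count: the arcs of length [s] starting at points of [S] in [[i, j)] stay there, and
    the other arcs stay in the complement. If [m] points of [S] lie in [[i, j)], then
    [m * s <= j - i] and [(k - m) * s <= n - (j - i)]. *)
Lemma stable_pair_gap (n k s : nat) (S : {set 'I_n}) (i j : 'I_n) :
  0 < s -> S \in stable_sets n k s -> i \in S -> j \in S -> i < j ->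
  stable_gap k s (n - k * s) (j - i).
Proof.
rewrite inE => s0 /andP[/eqP cardS /stableP stS] iS jS ij.
have n0 : 0 < n by have := ltn_ord i; lia.
pose sh (u : 'I_n * 'I_s) : 'I_n := Ordinal (ltn_pmod (u.1 + u.2) n0).
have shE u : sh u = (if u.1 + u.2 < n then u.1 + u.2 else u.1 + u.2 - n) :> nat.
  have hu := ltn_ord u.1; have ht := ltn_ord u.2.
  rewrite /sh /=; case: ltnP => h; first by rewrite modn_small.
  have := stS _ _ iS jS ij; have := ltn_ord j => ? ?.
  by rewrite -{1}(subnK h) modnDr modn_small //; lia.
have sn : s <= n by have := stS _ _ iS jS ij; lia.
have sep x y : x \in S -> y \in S -> x < y -> s <= y - x <= n - s by exact: stS.
(* The arcs [x, x + s) for x in S are pairwise disjoint in the cycle. *)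
have sh_inj : {in setX S [set: 'I_s] &, injective sh}.
  move=> [x t] [y u]; rewrite !inE /= !andbT => xS yS sh_eq.
  have : sh (x, t) = sh (y, u) :> nat by rewrite sh_eq.
  rewrite !shE /=.
  have := ltn_ord x; have := ltn_ord y; have := ltn_ord t; have := ltn_ord u.
  move=> hu ht hy hx e.
  have exy : x = y :> nat.
    case: (ltngtP x y) => // h;
    [have := sep _ _ xS yS h|have := sep _ _ yS xS h];
    move: e; case: (ltnP (x + t)); case: (ltnP (y + u)); lia.
  congr pair; apply: val_inj => //=.
  by move: e; rewrite exy; case: (ltnP (y + t)); case: (ltnP (y + u)); lia.
pose I := [set x : 'I_n | i <= x < j].
have cardI : #|I| = j - i.
  rewrite -[RHS]card_ord.
  have f_lt (t : 'I_(j - i)) : i + t < n.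
    by have := ltn_ord t; have := ltn_ord j; lia.
  rewrite -(card_imset (f := fun t => Ordinal (f_lt t))).
    apply: eq_card => x; rewrite inE; apply/idP/imsetP => [hx|[t _ ->] /=].
      have hx' : x - i < j - i by lia.
      by exists (Ordinal hx') => //; apply: val_inj => /=; lia.
    by have := ltn_ord t; lia.
  by move=> t u /(congr1 val) /= e; apply: val_inj => /=; lia.
have bound (T J : {set 'I_n}) : T \subset S ->
    (forall x (t : 'I_s), x \in T -> sh (x, t) \in J) -> #|T| * s <= #|J|.
  move=> TS TJ; rewrite -[s in X in X <= _]card_ord -cardsT -cardsX.
  rewrite -(card_in_imset (f := sh)).
    apply/subset_leq_card/subsetP => _ /imsetP[[x t] + ->].
    by rewrite !inE /= andbT; exact: TJ.
  move=> u v; rewrite !inE !andbT => uT vT.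
  by apply: sh_inj; rewrite !inE andbT (subsetP TS).
have b1 : #|S :&: I| * s <= j - i.
  rewrite -cardI; apply: bound; first exact: subsetIl.
  move=> x t; rewrite !inE => /and3P[xS ix xj]; rewrite shE /=.
  have := sep _ _ xS jS xj; have := ltn_ord t; have := ltn_ord j.
  case: (ltnP (x + t)); lia.
have b2 : #|S :\: I| * s <= n - (j - i).
  have -> : n - (j - i) = #|~: I| by rewrite cardsCs setCK card_ord cardI.
  apply: bound; first exact: subsetDl.
  move=> x t; rewrite !inE => /andP[xI xS]; rewrite shE /=.
  have := ltn_ord t; have := ltn_ord j; have := ltn_ord x.
  case: (ltnP x i) => xi.
    have := sep _ _ xS iS xi; case: (ltnP (x + t)); lia.
  have jx : j <= x by lia.
  have := sep _ _ iS jS ij.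
  case: (ltngtP i x) => [ix||/val_inj e]; [|lia|by move: ij jx; rewrite e; lia].
  have := sep _ _ iS xS ix; case: (ltnP (x + t)); lia.
have iI : i \in S :&: I by rewrite !inE iS leqnn.
have jI : j \in S :\: I by rewrite !inE jS ltnn andbF.
have := cardsID I S; rewrite cardS => kE.
have a0 : 0 < #|S :&: I| by apply/card_gt0P; exists i.
have c0 : 0 < #|S :\: I| by apply/card_gt0P; exists j.
apply/stable_gapP; exists #|S :&: I|; split=> //.
  by rewrite -kE -[X in X < _]addn0 ltn_add2l.
rewrite -kE mulnDl; move: b1 b2; set u := _ * s; set v := _ * s; lia.
Qed.

Lemma stable_gap_pair (n k s : nat) (i j : 'I_n) :
  k * s <= n -> 0 < s -> i < j -> stable_gap k s (n - k * s) (j - i) ->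
  exists2 S, S \in stable_sets n k s & [set i; j] \subset S.
Proof.
move=> hn s0 ij /stable_gapP[m [m0 mk h1 h2]].
have hj := ltn_ord j.
have n0 : 0 < n by lia.
(* Positions before reduction modulo [n]: [m] points in steps of [s] from [i], then [k - m] from
   [j]. The lower bound on [j - i] leaves room before [j], the upper bound leaves room before
   returning to [i]. *)
pose f t := if t < m then i + t * s else j + (t - m) * s.
have f_sep t u : t < u < k -> s <= f u - f t <= n - s /\ f t < f u.
  move=> /andP[tu uk]; rewrite /f.
  have km : (k - m) * s = k * s - m * s by rewrite mulnBl.
  have ks := mulnS_le s mk.
  have tus := mulnS_le s tu.
  case: (ltnP t m) => tm; case: (ltnP u m) => um; last 2 first.
  - lia.
  - have /(mulnS_le s) a : t - m < u - m by lia.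
    have /(mulnS_le s) b : u - m < k - m by lia.
    split; lia.
  - have := mulnS_le s um; split; lia.
  have a := mulnS_le s tm; have /(mulnS_le s) b : u - m < k - m by lia.
  split; lia.
pose g (t : 'I_k) : 'I_n := Ordinal (ltn_pmod (f t) n0).
have f0 : f 0 = i by rewrite /f m0 mul0n addn0.
have f_lt t : t < k -> f t < i + n.
  move=> tk; case: (posnP t) => [->|t0]; first by rewrite f0; lia.
  by have [|] := f_sep 0 t; rewrite ?t0 ?f0 //; lia.
have f_ge t : t < k -> i <= f t.
  move=> tk; case: (posnP t) => [->|t0]; first by rewrite f0.
  by have [|] := f_sep 0 t; rewrite ?t0 ?f0 //; lia.
have gE (t : 'I_k) : g t = (if f t < n then f t else f t - n) :> nat.
  rewrite /g /=; have := f_lt t (ltn_ord t) => ft.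
  case: ltnP => h; first by rewrite modn_small.
  by rewrite -{1}(subnK h) modnDr modn_small //; have := ltn_ord i; lia.
(* Reduction may reverse the order of the two points; as subtraction truncates, only the disjunct
   for the actual order can hold. *)
have g_sep (t u : 'I_k) : t < u ->
    s <= g u - g t <= n - s \/ s <= g t - g u <= n - s.
  move=> tu; have [|] := f_sep t u; first by rewrite tu ltn_ord.
  have := f_lt t (ltn_ord t); have := f_lt u (ltn_ord u).
  have := f_ge t (ltn_ord t); have := f_ge u (ltn_ord u).
  rewrite !gE; case: (ltnP (f t) n); case: (ltnP (f u) n); lia.
have g_inj : injective g.
  move=> t u e; apply: val_inj; case: (ltngtP t u) => // tu.
    by case: (g_sep _ _ tu); rewrite e; lia.
  by case: (g_sep _ _ tu); rewrite e; lia.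
exists [set g t | t : 'I_k]; last first.
  apply/subsetP => x; rewrite !inE => /orP[] /eqP->.
    have k0 : 0 < k by lia.
    apply/imsetP; exists (Ordinal k0) => //; apply: ord_inj.
    by rewrite gE /= f0; case: ltnP => //; have := ltn_ord i; lia.
  apply/imsetP; exists (Ordinal mk) => //; apply: ord_inj.
  by rewrite gE /= /f ltnn subnn mul0n addn0; case: ltnP => //; lia.
rewrite inE card_imset // card_ord eqxx /=; apply/stableP.
move=> _ _ /imsetP[t _ ->] /imsetP[u _ ->] gtu.
case: (ltngtP t u) => tu.
- by case: (g_sep _ _ tu); lia.
- by case: (g_sep _ _ tu); lia.
by move: gtu; rewrite (val_inj tu) ltnn.
Qed.

Lemma G_sym (n k s : nat) (x y : 'I_n) : G k s x y = G k s y x.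
Proof. by rewrite /G eq_sym setUC. Qed.

Lemma G_stable_gap (n k s : nat) (x y : 'I_n) : k * s <= n -> 0 < s ->
  G k s x y = (x != y) && ~~ stable_gap k s (n - k * s) (cdist n x y).
Proof.
move=> hn s0.
have lt_case (i j : 'I_n) : i < j ->
    G k s i j = ~~ stable_gap k s (n - k * s) (j - i).
  move=> ij; rewrite /G neq_ltn ij /=; congr (~~ _).
  apply/exists_inP/idP => [[S SS /subsetP ijS]|h].
    apply: (stable_pair_gap s0 SS) => //;
      by apply: ijS; rewrite !inE eqxx ?orbT.
  by have [S ? ?] := stable_gap_pair hn s0 ij h; exists S.
have nE : n = k * s + (n - k * s) by lia.
rewrite /cdist; case: (ltngtP x y) => [xy|yx|/val_inj ->].
- by rewrite lt_case // neq_ltn xy.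
- rewrite G_sym lt_case // neq_ltn yx orbT /=; congr (~~ _).
  have hx := ltn_ord x.
  have -> : y + n - x = n - (x - y) by lia.
  apply/idP/idP => [|h]; first by apply: (stable_gap_compl nE); lia.
  have -> : x - y = n - (n - (x - y)) by lia.
  by apply: (stable_gap_compl nE) => //; lia.
by rewrite /G eqxx.
Qed.

(** * Translating blocks by a non-stable distance *)

(* For a, d < n this is (a + d) mod n. *)
Definition cadd (n a d : nat) : nat := if a + d < n then a + d else a + d - n.

Lemma stable_gapN_between (k s r i d : nat) :
  i * s + r < d -> d < i.+1 * s -> ~~ stable_gap k s r d.
Proof.
move=> h1 h2; apply/stable_gapP => -[m [m0 mk h3 h4]].
case: (ltnP i m) => im.
  by have := mulnS_le s im; rewrite mulSn in h2; lia.
have : m * s <= i * s by rewrite leq_mul2r im orbT.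
lia.
Qed.

Lemma stable_gapN_low (k s r d : nat) : d < s -> ~~ stable_gap k s r d.
Proof.
by move=> ds; apply/stable_gapP => -[m [m0 _ h _]]; have := mulnS_le s m0; lia.
Qed.

Lemma stable_gapN_high (n k s r d : nat) :
  n = k * s + r -> n < d + s -> ~~ stable_gap k s r d.
Proof.
move=> -> ds; apply/stable_gapP => -[m [_ mk _ h]].
by have := mulnS_le s mk; lia.
Qed.

(** Blocks are separated and of equal size, so a translated block that loses no point coincides with
    a block, which would make [d] stable or [0] modulo [n]. *)
Lemma block_loses_one (n k s r d j : nat) :
  n = k * s + r -> r.+1 < s -> 0 < d < n -> ~~ stable_gap k s r d ->
  0 < j < k ->
  exists a, [/\ j * s <= a, a <= j * s + r & ~~ stable_gap k s r (cadd n a d)].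
Proof.
move=> nE rs /andP[d0 dn] gapd /andP[j0 jk].
case: (boolP (stable_gap k s r (cadd n (j * s) d))) => [|h]; last first.
  by exists (j * s); split=> //; lia.
case/stable_gapP => i [i0 ik h1 h2].
have jks := mulnS_le s jk; have iks := mulnS_le s ik.
case: (ltnP (i * s) (cadd n (j * s) d)) => [h3|h3]; last first.
  (* Left end goes to left end: [d] is then the left end of block [i - j] or the right end of block
     [k - (j - i)]. *)
  case/negP: gapd; apply/stable_gapP.
  have {h1 h2 h3} h : cadd n (j * s) d = i * s by lia.
  case: (ltngtP i j) => ij; last 1 first.
  - by move: h; rewrite /cadd ij; case: (ltnP (j * s + d) n); lia.
  - exists (k - (j - i)); rewrite !mulnBl; have := mulnS_le s ij.
    by move: h; rewrite /cadd; case: (ltnP (j * s + d) n); split; lia.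
  exists (i - j); rewrite mulnBl; have := mulnS_le s ij.
  by move: h; rewrite /cadd; case: (ltnP (j * s + d) n); split; lia.
(* The translate overruns block [i]: the chosen point goes to [i * s + r.+1], short of the next
   block since [r.+1 < s]. *)
pose u := cadd n (j * s) d - i * s.
exists (j * s + (r.+1 - u)); split; [lia|lia|].
have -> : cadd n (j * s + (r.+1 - u)) d = i * s + r.+1.
  move: h1 h2 h3; rewrite /u /cadd.
  by case: (ltnP (j * s + d) n); case: (ltnP (j * s + (r.+1 - _) + d) n); lia.
by apply: (@stable_gapN_between _ _ _ i); rewrite ?mulSn; lia.
Qed.

(** Points of the cycle at distance less than [s] from [0] belong to no block; in each case two
    consecutive points of one block are moved there. *)
Lemma some_block_loses_two (n k s r d : nat) :
  n = k * s + r -> 0 < s -> 0 < r -> 1 < k -> 1 < d < n.-1 ->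
  ~~ stable_gap k s r d ->
  exists j a, [/\ 0 < j < k, j * s <= a < j * s + r,
    ~~ stable_gap k s r (cadd n a d) & ~~ stable_gap k s r (cadd n a.+1 d)].
Proof.
move=> nE s0 r0 k1 /andP[d1 dn] gapd.
have k'k : k.-1 * s = k * s - s by rewrite -subn1 mulnBl mul1n.
have ks : 2 * s <= k * s by rewrite leq_mul2r k1 orbT.
case: (ltnP d s) => ds.
  (* The last block ends at [n - s], and [1 < d] carries its last two points past that end. *)
  exists k.-1, (n - s).-1; split; [lia|lia| |]; rewrite /cadd.
    case: (ltnP ((n - s).-1 + d) n) => h; last by apply: stable_gapN_low; lia.
    by apply: (stable_gapN_high nE); lia.
  case: (ltnP ((n - s).-1.+1 + d) n) => h; last by apply: stable_gapN_low; lia.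
  by apply: (stable_gapN_high nE); lia.
case: (ltnP (n - s) d) => nsd.
  exists 1, s; split; [lia|lia| |]; rewrite /cadd.
    by case: (ltnP (s + d) n) => h; [lia|apply: stable_gapN_low; lia].
  by case: (ltnP (s.+1 + d) n) => h; [lia|apply: stable_gapN_low; lia].
have dk : d < k.-1 * s.
  rewrite ltnNge; apply: contra gapd => dk.
  by apply/stable_gapP; exists k.-1; split; lia.
have mk : d %/ s < k.-1 by rewrite ltn_divLR.
have m0 : 0 < d %/ s by rewrite divn_gt0.
have dE := divn_eq d s; have qs := ltn_pmod d s0.
move: (d %/ s) (d %% s) mk m0 dE qs => m q mk m0 dE qs.
have rq : r < q.
  rewrite ltnNge; apply: contra gapd => qr.
  by apply/stable_gapP; exists m; split; lia.
(* Since [d = m * s + q], this left end moves to [k.-1 * s + q], beyond the last block because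
   [r < q]. *)
exists (k.-1 - m), ((k.-1 - m) * s).
have jm : (k.-1 - m) * s = k.-1 * s - m * s by rewrite mulnBl.
have := mulnS_le s mk => mks.
split; [lia|lia| |]; rewrite /cadd.
  case: (ltnP ((k.-1 - m) * s + d) n) => h; last lia.
  by apply: (stable_gapN_high nE); lia.
case: (ltnP (((k.-1 - m) * s).+1 + d) n) => h; last lia.
by apply: (stable_gapN_high nE); lia.
Qed.

(** * Lost non-neighbours and the arithmetic of cyclic distance *)

Definition lost (T : finType) (e : rel T) (x y : T) : {set T} :=
  [set z | [&& x != z, ~~ e x z & ~~ ((y != z) && ~~ e y z)]].

Lemma card_lost_aut (T : finType) (e : rel T) (p : {perm T}) (x y : T) :
  p \in graph_aut e -> #|lost e (p x) (p y)| = #|lost e x y|.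
Proof.
move=> /graph_autP pe; rewrite -(card_imset (mem (lost e x y)) (@perm_inj _ p)).
apply: eq_card => z; rewrite -[z](permKV p) mem_imset; last exact: perm_inj.
by rewrite !inE !pe !(inj_eq (@perm_inj _ p)).
Qed.

Lemma cdist_inj (n : nat) (x : 'I_n) : injective (fun z : 'I_n => cdist n x z).
Proof.
move=> z t; rewrite /cdist => h; apply: ord_inj; move: h.
have := ltn_ord x; have := ltn_ord z; have := ltn_ord t.
by case: (leqP x z); case: (leqP x t); lia.
Qed.

Lemma cdist_surj (n : nat) (x : 'I_n) (a : nat) :
  a < n -> exists z : 'I_n, cdist n x z = a.
Proof.
move=> an; have hx := ltn_ord x.
have zn : cadd n x a < n by rewrite /cadd; case: (ltnP (x + a) n); lia.
exists (Ordinal zn); rewrite /cdist /= /cadd.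
by case: (ltnP (x + a) n) => h;
  [case: (leqP x (x + a))|case: (leqP x (x + a - n))]; lia.
Qed.

(** Changing the base point from [x] to [y] translates all distances by [cdist n y x], which turns
    lost vertices into points leaving the blocks. *)
Lemma cdist_add (n : nat) (x y z : 'I_n) :
  cdist n y z = cadd n (cdist n x z) (cdist n y x).
Proof.
have hx := ltn_ord x; have hy := ltn_ord y; have hz := ltn_ord z.
rewrite /cadd /cdist.
by case: (leqP y z); case: (leqP x z); case: (leqP y x) => h1 h2 h3;
  case: ltnP; lia.
Qed.

Lemma cdist_compl (n : nat) (x y : 'I_n) :
  x != y -> cdist n x y + cdist n y x = n.
Proof.
rewrite neq_ltn /cdist; have := ltn_ord x; have := ltn_ord y.
by case: (ltngtP x y) => /=; lia.
Qed.

Lemma cdist_gt0 (n : nat) (x y : 'I_n) : x != y -> 0 < cdist n x y.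
Proof.
rewrite neq_ltn /cdist; have := ltn_ord x; have := ltn_ord y.
by case: (ltngtP x y) => /=; lia.
Qed.

(** * Counting lost vertices block by block *)

Section GapGraph.

Variables (n k s r : nat) (e : rel 'I_n).
Hypothesis nE : n = k * s + r.
Hypothesis s1 : 1 < s.
Hypothesis r0 : 0 < r.
Hypothesis k1 : 1 < k.
Hypothesis eE : forall x y : 'I_n,
  e x y = (x != y) && ~~ stable_gap k s r (cdist n x y).

Lemma in_lost (x y z : 'I_n) : (z \in lost e x y) =
  stable_gap k s r (cdist n x z) && ~~ stable_gap k s r (cdist n y z).
Proof.
have gap (u : 'I_n) : stable_gap k s r (cdist n u z) = (u != z) && ~~ e u z.
  rewrite eE; case: eqVneq => [->|_] /=; last by rewrite negbK.
  by apply/negbTE/stable_gapN_low; rewrite /cdist leqnn subnn; lia.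
by rewrite !gap inE -!andbA.
Qed.

(** The translation is by [-1] modulo [n], so lost vertices have distances among the left ends
    [s, 2 * s, ..., k.-1 * s]. *)
Lemma card_lost_succ (x y : 'I_n) :
  cdist n x y = 1 -> #|lost e x y| < k.
Proof.
move=> xy.
have yx : cdist n y x = n.-1.
  move: xy; have := ltn_ord x; have := ltn_ord y; rewrite /cdist.
  by case: (leqP x y); case: (leqP y x); lia.
rewrite cardE -(size_map (fun z : 'I_n => cdist n x z)).
rewrite -[X in _ < X](prednK (ltnW k1)) ltnS.
rewrite -[X in _ <= X](size_iota 1) -[X in _ <= X](size_map (muln^~ s)).
apply: uniq_leq_size.
  by rewrite map_inj_uniq ?enum_uniq //; exact: cdist_inj.
move=> a /mapP[z]; rewrite mem_enum in_lost => /andP[] + + ->.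
rewrite (cdist_add x y) yx; move: (cdist n x z) => {}a.
case/stable_gapP => m [m0 mk h1 h2] gapN.
apply/mapP; exists m; first by rewrite mem_iota; lia.
apply/eqP; rewrite eqn_leq h1 andbT leqNgt; apply: contra gapN => h3.
apply/stable_gapP; exists m; have := mulnS_le s mk.
by rewrite /cadd; case: (ltnP (a + n.-1) n); split; lia.
Qed.

(** One block loses two vertices. For [k = 2] it is the only block; otherwise [r.+1 < s] makes each
    of the others lose one. *)
Lemma card_lost_far (x y : 'I_n) : k = 2 \/ r.+1 < s ->
  e x y -> cdist n x y != 1 -> cdist n y x != 1 -> k <= #|lost e x y|.
Proof.
move=> kr exy xy1 yx1.
have xy : x != y by move: exy; rewrite eE; case/andP.
have gapd : ~~ stable_gap k s r (cdist n y x).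
  have := exy; rewrite eE => /andP[_]; apply: contra => h.
  have -> : cdist n x y = n - cdist n y x.
    by have := cdist_compl xy; lia.
  apply: (stable_gap_compl nE) => //; rewrite /cdist.
  by have := ltn_ord x; have := ltn_ord y; case: (leqP y x); lia.
have dn : 1 < cdist n y x < n.-1.
  have := cdist_compl xy; have := cdist_gt0 xy.
  by have := @cdist_gt0 n y x; rewrite eq_sym => /(_ xy); lia.
have [j0 [a0 [j0k a0j l0 l1]]] :=
  some_block_loses_two nE (ltnW s1) r0 k1 dn gapd.
have blk j a : 0 < j < k -> j * s <= a <= j * s + r ->
    a < n /\ stable_gap k s r a.
  move=> /andP[j_gt0 jk] ha; split; first by have := mulnS_le s jk; lia.
  by apply/stable_gapP; exists j; split; lia.
have lostP a : a < n -> stable_gap k s r a ->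
    ~~ stable_gap k s r (cadd n a (cdist n y x)) ->
    exists2 z : 'I_n, z \in lost e x y & cdist n x z = a.
  move=> an ga gN; have [z za] := cdist_surj x an.
  by exists z; rewrite // in_lost (cdist_add x y z) za ga gN.
have [a1n ga1] : a0.+1 < n /\ stable_gap k s r a0.+1 by apply: blk j0k _; lia.
have [a0n ga0] : a0 < n /\ stable_gap k s r a0 by apply: blk j0k _; lia.
have [z1 z1L z1E] := lostP _ a1n ga1 l1.
have [z0 z0L z0E] := lostP _ a0n ga0 l0.
(* With [z1] set aside, the remaining lost vertices still meet all [k.-1] blocks, [z0] serving block
   [j0]. *)
rewrite (cardsD1 z1) z1L add1n -[X in X <= _](prednK (ltnW k1)) ltnS.
(* Sends a point of the block [j * s, j * s + r] to j; the truncation only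
   matters when k = 2, where that block may be longer than s. *)
pose blockof (z : 'I_n) := minn (cdist n x z %/ s) k.-1.
rewrite cardE -(size_map blockof) -[X in X <= _](size_iota 1).
apply: uniq_leq_size; first exact: iota_uniq.
have blockofE j a (z : 'I_n) : 0 < j < k -> j * s <= a <= j * s + r ->
    cdist n x z = a -> blockof z = j.
  move=> jk ha za; rewrite /blockof za.
  have : j <= a %/ s by rewrite leq_divRL; lia.
  case: kr => [k2|rs]; first by lia.
  suff : a %/ s < j.+1 by lia.
  by rewrite ltn_divLR ?mulSn; lia.
move=> j; rewrite mem_iota => hj.
have jk : 0 < j < k by lia.
case: (eqVneq j j0) => [->|jj0].
  apply/mapP; exists z0; last by rewrite (blockofE j0 a0) //; lia.
  by rewrite mem_enum in_setD1 z0L andbT; apply/eqP => h;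
    move: z0E; rewrite h; lia.
have rs : r.+1 < s by case: kr => //; lia.
have [|a [ha1 ha2 la]] := block_loses_one nE rs _ gapd jk; first by lia.
have [an ga] : a < n /\ stable_gap k s r a by apply: blk jk _; lia.
have [z zL zE] := lostP _ an ga la.
apply/mapP; exists z; last by rewrite (blockofE j a) //; lia.
rewrite mem_enum in_setD1 zL andbT; apply: contra jj0 => /eqP zz1.
have : blockof z = j0 by apply: (blockofE j0 a0.+1); rewrite ?zz1 //; lia.
by rewrite (blockofE j a) //; [move=> ->|lia].
Qed.

(** A successor pair is adjacent and loses fewer than [k] vertices; its image inherits both
    properties, so it cannot be far apart. *)
Lemma aut_succ (p : {perm 'I_n}) (x y : 'I_n) : k = 2 \/ r.+1 < s ->
  p \in graph_aut e -> cdist n x y = 1 ->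
  cdist n (p x) (p y) = 1 \/ cdist n (p y) (p x) = 1.
Proof.
move=> kr pA xy.
have exy : e x y.
  rewrite eE xy stable_gapN_low // andbT; apply/eqP => h; move: xy.
  by rewrite h /cdist leqnn subnn.
case: (eqVneq (cdist n (p x) (p y)) 1) => [|h1]; first by left.
case: (eqVneq (cdist n (p y) (p x)) 1) => [|h2]; first by right.
have := card_lost_succ xy; rewrite -(card_lost_aut x y pA) ltnNge.
by rewrite card_lost_far // (graph_autP _ _ pA).
Qed.

End GapGraph.

(** * Rotation, reflection and automorphisms of the cycle *)

Lemma val_rotation (n : nat) (z : 'I_n) :
  rotation n z = (if z.+1 < n then z.+1 else 0) :> nat.
Proof.
rewrite permE /=; case: ltnP => h; first by rewrite modn_small.
have -> : z.+1 = n by have := ltn_ord z; lia.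
exact: modnn.
Qed.

Lemma val_reflection (n : nat) (z : 'I_n) :
  reflection n z = (if z == 0 :> nat then 0 else n - z) :> nat.
Proof.
rewrite permE /=; case: eqP => [->|h]; first by rewrite subn0 modnn.
by rewrite modn_small //; have := ltn_ord z; lia.
Qed.

Lemma cdist_rotation (n : nat) (x y : 'I_n) :
  cdist n (rotation n x) (rotation n y) = cdist n x y.
Proof.
rewrite /cdist !val_rotation; have := ltn_ord x; have := ltn_ord y.
by case: (ltnP x.+1 n); case: (ltnP y.+1 n) => h1 h2 h3 h4;
  case: (leqP x y) => h5; case: leqP; lia.
Qed.

Lemma cdist_reflection (n : nat) (x y : 'I_n) :
  cdist n (reflection n x) (reflection n y) = cdist n y x.
Proof.
rewrite /cdist !val_reflection; have := ltn_ord x; have := ltn_ord y.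
by case: (eqVneq (x : nat) 0) => h1; case: (eqVneq (y : nat) 0) => h2 h3 h4;
  case: (leqP y x) => h5; case: leqP; lia.
Qed.

Lemma cdist_succ (n : nat) (x y : 'I_n) : 1 < n ->
  (cdist n x y = 1) <-> (y = rotation n x).
Proof.
move=> n1; have hx := ltn_ord x; have hy := ltn_ord y.
split=> [|->]; rewrite /cdist.
  move=> h; apply: ord_inj; rewrite val_rotation; move: h.
  by case: (leqP x y); case: (ltnP x.+1 n); lia.
rewrite val_rotation; case: (ltnP x.+1 n) => h; case: leqP; lia.
Qed.

(** The dihedral relation: the reflection conjugates the rotation to its inverse. *)
Lemma rotation_reflection (n : nat) (x : 'I_n) :
  rotation n (reflection n (rotation n x)) = reflection n x.
Proof.
apply: ord_inj; have := ltn_ord x; rewrite val_rotation !val_reflection.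
rewrite val_rotation; case: (ltnP x.+1 n) => h /=;
  case: (eqVneq (x : nat) 0) => h1 h2; case: ltnP; lia.
Qed.

Lemma rotation_orbit (n : nat) (x0 y : 'I_n) :
  x0 = 0 :> nat -> (rotation n ^+ y)%g x0 = y.
Proof.
move=> x00; apply: ord_inj.
have h i : i < n -> (rotation n ^+ i)%g x0 = i :> nat.
  elim: i => [|i IH] hi; first by rewrite expg0 perm1.
  by rewrite expgSr permM val_rotation IH ?hi // ltnW.
exact: h.
Qed.

Lemma rotation_ind (n : nat) (P : 'I_n -> Prop) (x0 : 'I_n) :
  x0 = 0 :> nat -> P x0 -> (forall x, P x -> P (rotation n x)) -> forall x, P x.
Proof.
move=> x00 P0 PS x; rewrite -(rotation_orbit x x00).
elim: (x : nat) => [|i IH]; first by rewrite expg0 perm1.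
by rewrite expgSr permM; apply: PS.
Qed.

(** The rotation is transitive, so a permutation commuting with it is determined by the image of [0]
    and is a power of it. *)
Lemma commute_rotation_dihedral (n : nat) (x0 : 'I_n) (p : {perm 'I_n}) :
  x0 = 0 :> nat -> (forall x, p (rotation n x) = rotation n (p x)) ->
  p \in dihedral n.
Proof.
move=> x00 pr.
have -> : p = (rotation n ^+ p x0)%g.
  apply/permP; apply: (rotation_ind x00); first by rewrite rotation_orbit.
  by move=> x IH; rewrite pr IH -!permM -expgS -expgSr.
by apply: groupX; apply: mem_gen; rewrite !inE eqxx.
Qed.

(** Each step of the cycle is sent to a step forward or backward. A change of direction would
    identify the images of [x] and [x + 2], distinct as [2 < n], so the direction at [0]
    propagates. *)
Lemma cycle_aut_dihedral (n : nat) (p : {perm 'I_n}) : 2 < n ->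
  (forall x, p (rotation n x) = rotation n (p x) \/
             rotation n (p (rotation n x)) = p x) ->
  p \in dihedral n.
Proof.
move=> n2 pr; have n0 : 0 < n by lia.
pose x0 := Ordinal n0.
have no_fold x : p (rotation n (rotation n x)) <> p x.
  move=> /perm_inj /(congr1 (@nat_of_ord n)); rewrite !val_rotation.
  by have := ltn_ord x; case: (ltnP x.+1 n) => h1 h2; case: ltnP; lia.
case: (pr x0) => h0.
  apply: (@commute_rotation_dihedral _ x0) => //.
  apply: (rotation_ind (x0 := x0)) => // x hx.
  case: (pr (rotation n x)) => // h; case: (no_fold x).
  by apply: (@perm_inj _ (rotation n)); rewrite h hx.
have hr x : rotation n (p (rotation n x)) = p x.
  move: x; apply: (rotation_ind (x0 := x0)) => // x hx.
  by case: (pr (rotation n x)) => // h; case: (no_fold x); rewrite h hx.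
have refl_in : reflection n \in dihedral n.
  by apply: mem_gen; rewrite !inE eqxx orbT.
(* If [p] reverses direction, following it by the reflection restores the direction. *)
rewrite -(groupMr _ refl_in); apply: (@commute_rotation_dihedral _ x0) => // x.
by rewrite !permM -(hr x) rotation_reflection.
Qed.

Theorem theorem4 (n s k : nat) (hk : 2 <= k) (hs : 3 <= s)
    (hn : s * k + 1 <= n) :
  graph_aut (@G n k s) = dihedral n :> {set {perm 'I_n}}.
Proof.
have kn : k * s < n by rewrite mulnC; lia.
have sn : 2 * s <= k * s by rewrite leq_mul2r hk orbT.
have s0 : 0 < s by lia.
have GE (x y : 'I_n) := G_stable_gap x y (ltnW kn) s0.
apply/eqP; rewrite eqEsubset; apply/andP; split; last first.
  rewrite gen_subG; apply/subsetP => p; rewrite !inE.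
  case/orP => /eqP ->; apply/forallP => x; apply/forallP => y; apply/eqP.
    by rewrite !GE cdist_rotation (inj_eq (@perm_inj _ _)).
  by rewrite [RHS]G_sym !GE cdist_reflection (inj_eq (@perm_inj _ _)) eq_sym.
apply/subsetP => p pA; apply: cycle_aut_dihedral => [|x]; first by lia.
have n1 : 1 < n by lia.
have xS : cdist n x (rotation n x) = 1 by apply/cdist_succ.
suff : cdist n (p x) (p (rotation n x)) = 1 \/
    cdist n (p (rotation n x)) (p x) = 1.
  by case=> /(cdist_succ _ _ n1) h; [left|right].
have nE : n = k * s + (n - k * s) by lia.
(* Either the blocks are separated, or the same graph is presented with [k = 2] and slack
   [n - 2 * s]. *)
case: (ltnP (n - k * s).+1 s) => rs.
  by apply: (aut_succ nE _ _ _ GE) => //; [lia|lia|right].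
have n2E : n = 2 * s + (n - 2 * s) by lia.
apply: (aut_succ n2E (e := G k s)) => //; [lia|lia| |by left].
by move=> u v; rewrite GE (stable_gap_collapse _ hk nE rs).
Qed.
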